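(* Let $(L,\omega)$ be a finite-dimensional quadratic Lie algebra over a field $F$ of characteristic $0$, let $r=\sum_i a_i\otimes b_i\in L\otimes L$, let $R:L\to L$ be the linear operator $R(a)=\sum_i\omega(b_i,a)a_i$, let $R^*$ be the adjoint of $R$ with respect to $\omega$, and let $\lambda\in F$. 1. Suppose that $r$ is a solution of the classical Yang–Baxter equation on $L$ such that $r+\tau(r)$ is $L$-invariant. If $R$ is a Rota–Baxter operator of weight $\lambda$, then there is an ideal $I_\lambda$ of $L$ such that $I_\lambda\subset[L,L]$, $R(I_\lambda)=0$, and the operator induced by $R$ on the quotient algebra $L/I_\lambda$ is a Rota–Baxter operator of weight $\lambda$ satisfying $$R(x)+R^*(x)+\lambda x=0\quad\text{for all } x\in[L/I_\lambda,L/I_\lambda].\qquad(\ast)$$ 2. Conversely, suppose that $r+\tau(r)\neq 0$, that $R$ is a Rota–Baxter operator of weight $\lambda$ on $L$, and that $R([a,b])+R^*([a,b])=[R(a),b]+[R^*(a),b]$ for all $a,b\in L$. Suppose there is an ideal $I_\lambda$ of $L$ with $I_\lambda\subset[L,L]$ and $R(I_\lambda)=0$, and suppose in addition that the operator induced by $R$ on $L/I_\lambda$ is a Rota–Baxter operator of weight $\lambda$ satisfying $(\ast)$. Then $r$ is a solution of the classical Yang–Baxter equation and $r+\tau(r)$ is a nonzero $L$-invariant element.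
   Context: A quadratic Lie algebra $(L,\omega)$ is a Lie algebra $L$ with a non-degenerate symmetric bilinear form $\omega$ that is invariant: $\omega([a,b],c)=\omega(a,[b,c])$ for all $a,b,c\in L$. The adjoint $R^*$ of $R$ is defined by $\omega(R(x),y)=\omega(x,R^*(y))$ for all $x,y\in L$. An element $r=\sum_i a_i\otimes b_i\in L\otimes L$ is a solution of the classical Yang–Baxter equation (CYBE) if $$\sum_{i,j}\big([a_i,a_j]\otimes b_i\otimes b_j-a_i\otimes[a_j,b_i]\otimes b_j+a_i\otimes a_j\otimes[b_i,b_j]\big)=0 .$$ $\tau$ is the switch map, $\tau(\sum_i a_i\otimes b_i)=\sum_i b_i\otimes a_i$. An element $s=\sum_i c_i\otimes d_i\in L\otimes L$ is $L$-invariant if $[s,y]:=\sum_i([c_i,y]\otimes d_i+c_i\otimes[d_i,y])=0$ for all $y\in L$. A linear map $R$ on a Lie algebra $M$ over $F$ is a Rota–Baxter operator of weight $\lambda\in F$ if $[R(x),R(y)]=R([R(x),y]+[x,R(y)]+\lambda[x,y])$ for all $x,y\in M$. Condition $(\ast)$ is an identity in the quotient $L/I_\lambda$: it means that $R(x)+R^*(x)+\lambda x\in I_\lambda$ for all $x\in[L,L]$. Here $[L,L]$ denotes the linear span of all brackets. *)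

(* Defs.v *)
From HB Require Import structures.
From mathcomp Require Import all_boot all_order all_algebra.

Set Implicit Arguments.
Unset Strict Implicit.
Unset Printing Implicit Defensive.

Import GRing.Theory.
Local Open Scope ring_scope.
Local Open Scope quotient_scope.

HB.mixin Record Lmodule_isLieAlgebra (F : fieldType) L of GRing.Lmodule F L := {
  lie : L -> L -> L;
  lie_linearl : forall y, linear (lie^~ y);
  lie_linearr : forall x, linear (lie x);
  liexx : forall x, lie x x = 0;
  lie_jacobi : forall x y z,
    lie x (lie y z) + lie y (lie z x) + lie z (lie x y) = 0
}.

#[short(type="lieAlgType")]
HB.structure Definition LieAlgebra (F : fieldType) :=
  {L of Lmodule_isLieAlgebra F L & GRing.Lmodule F L}.

#[short(type="lieVectType")]
HB.structure Definition LieVector (F : fieldType) :=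
  {L of LieAlgebra F L & Vector F L}.

Notation "\[ x , y ]" := (lie x y)
  (at level 0, x, y at level 99, format "\[ x ,  y ]") : ring_scope.

Section LieTheory.
Variables (F : fieldType) (L : lieAlgType F).

Fact lie_bilinear : bilinear_for *:%R *:%R (@lie F L).
Proof. by split; [exact: lie_linearl | exact: lie_linearr]. Qed.

HB.instance Definition _ :=
  bilinear_isBilinear.Build F L L L *:%R *:%R (@lie F L) lie_bilinear.

Lemma lieC (x y : L) : \[x, y] = - \[y, x].
Proof.
apply/eqP; rewrite -addr_eq0; have /eqP := liexx (x + y).
by rewrite linearDl !linearDr /= !liexx add0r addr0.
Qed.

Definition in_derived (x : L) : Prop :=
  exists n (c : 'I_n -> F) (u v : 'I_n -> L), x = \sum_i c i *: \[u i, v i].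

Definition rota_baxter (lam : F) (R : L -> L) : Prop :=
  linear R /\
  forall x y, \[R x, R y] = R (\[R x, y] + \[x, R y] + lam *: \[x, y]).

End LieTheory.

Section Ideal.
Variables (F : fieldType) (L : lieVectType F).

(* By antisymmetry of the bracket, one-sided stability is enough. *)
Record ideal := Ideal {
  ideal_space :> {vspace L};
  idealP : forall x y, x \in ideal_space -> \[x, y] \in ideal_space
}.

Variable I : ideal.

(* Quotient.quot only provides the additive group L / I; scaling and bracket
   are added below. *)
Definition quot_lie : Type := Quotient.quot (pred_of_vspace I).
HB.instance Definition _ := ZmodQuotient.on quot_lie.

Definition quot_pi : L -> quot_lie := \pi_quot_lie.

Lemma quot_eqP x y : quot_pi x = quot_pi y <-> x - y \in ideal_space I.
Proof.
by rewrite -[_ - _ \in _]/(_ - _ \in pred_of_vspace I) Quotient.idealrBE;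
   split=> [/eqP | /eqP].
Qed.

Lemma quot_reprK x : quot_pi (repr x) = x.
Proof. exact: reprK. Qed.

Lemma quot_reprB x : repr (quot_pi x) - x \in ideal_space I.
Proof. by apply/quot_eqP; rewrite quot_reprK. Qed.

Lemma quot_piD x y : quot_pi (x + y) = quot_pi x + quot_pi y.
Proof. by rewrite /quot_pi !piE. Qed.

Definition quot_scale (c : F) (x : quot_lie) : quot_lie :=
  quot_pi (c *: repr x).

Lemma quot_piZ c x : quot_pi (c *: x) = quot_scale c (quot_pi x).
Proof.
by apply/quot_eqP; rewrite -scalerBr -opprB scalerN memvN memvZ ?quot_reprB.
Qed.

Fact quot_scaleA a b v : quot_scale a (quot_scale b v) = quot_scale (a * b) v.
Proof. by rewrite -[v]quot_reprK -!quot_piZ scalerA. Qed.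

Fact quot_scale1 : left_id 1 quot_scale.
Proof. by move=> v; rewrite -[v]quot_reprK -!quot_piZ scale1r. Qed.

Fact quot_scaleDr : right_distributive quot_scale +%R.
Proof.
move=> a u v; rewrite -[u]quot_reprK -[v]quot_reprK.
by rewrite -quot_piD -!quot_piZ -quot_piD scalerDr.
Qed.

Fact quot_scaleDl v : {morph quot_scale^~ v : a b / a + b}.
Proof.
move=> a b /=; rewrite -[v]quot_reprK.
by rewrite -!quot_piZ -quot_piD scalerDl.
Qed.

HB.instance Definition _ := GRing.Zmodule_isLmodule.Build F quot_lie
  quot_scaleA quot_scale1 quot_scaleDr quot_scaleDl.

Fact quot_pi_linear : linear quot_pi.
Proof. by move=> a x y; rewrite quot_piD quot_piZ. Qed.

HB.instance Definition _ :=
  GRing.isLinear.Build F L quot_lie *:%R quot_pi quot_pi_linear.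

Definition quot_bracket (x y : quot_lie) : quot_lie :=
  quot_pi \[repr x, repr y].

Lemma quot_pi_lie x y :
  quot_pi \[x, y] = quot_bracket (quot_pi x) (quot_pi y).
Proof.
apply/quot_eqP; set x' := repr _; set y' := repr _.
have -> : \[x, y] - \[x', y'] = \[y' - y, x'] - \[x' - x, y].
  rewrite !linearBl /= [\[y', x']]lieC [\[y, x']]lieC !opprK opprB.
  by rewrite -addrA (addrC \[x', y]) subrK addrC.
by rewrite memvB // idealP ?quot_reprB.
Qed.

Fact quot_lie_linearl y : linear (quot_bracket^~ y).
Proof.
move=> a u v; rewrite -[u]quot_reprK -[v]quot_reprK -[y]quot_reprK.
by rewrite -linearP -!quot_pi_lie linearPl linearP.
Qed.

Fact quot_lie_linearr x : linear (quot_bracket x).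
Proof.
move=> a u v; rewrite -[u]quot_reprK -[v]quot_reprK -[x]quot_reprK.
by rewrite -linearP -!quot_pi_lie linearPr linearP.
Qed.

Fact quot_liexx x : quot_bracket x x = 0.
Proof. by rewrite -[x]quot_reprK -quot_pi_lie liexx linear0. Qed.

Fact quot_jacobi x y z :
  quot_bracket x (quot_bracket y z) + quot_bracket y (quot_bracket z x)
    + quot_bracket z (quot_bracket x y) = 0.
Proof.
rewrite -[x]quot_reprK -[y]quot_reprK -[z]quot_reprK.
by rewrite -!quot_pi_lie -!linearD lie_jacobi linear0.
Qed.

HB.instance Definition _ := Lmodule_isLieAlgebra.Build F quot_lie
  quot_lie_linearl quot_lie_linearr quot_liexx quot_jacobi.

(* The operator induced on L / I; meaningful when R maps I into I
   (see quot_opE). *)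
Definition quot_op (R : L -> L) (x : quot_lie) : quot_lie :=
  quot_pi (R (repr x)).

Lemma quot_opE (R : L -> L) : linear R ->
  (forall x, x \in ideal_space I -> R x \in ideal_space I) ->
  forall x, quot_op R (quot_pi x) = quot_pi (R x).
Proof.
move=> linR RI x; apply/quot_eqP.
suff <- : R (repr (quot_pi x) - x) = R (repr (quot_pi x)) - R x.
  exact/RI/quot_reprB.
by rewrite -scaleN1r addrC linR scaleN1r addrC.
Qed.

End Ideal.
Arguments quot_lie {F L} I.
Arguments quot_op {F L} I R x.

(* The tensor product of finite-dimensional spaces, in coordinates with respect
   to the canonical bases; its universal property is tlift_tens, tlift_linear
   and tensor_ext. *)
Section Tensor.
Variable F : fieldType.

Definition tensor (U V : vectType F) : Type := 'M[F]_(\dim {:U}, \dim {:V}).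

HB.instance Definition _ U V := Vector.on (tensor U V).

Definition tens (U V : vectType F) (u : U) (v : V) : tensor U V :=
  \matrix_(i, j) (coord (vbasis {:U}) i u * coord (vbasis {:V}) j v).

(* The linear map induced by f on the tensor product, for f bilinear. *)
Definition tlift (U V : vectType F) (W : lmodType F) (f : U -> V -> W)
    (t : tensor U V) : W :=
  \sum_i \sum_j (t : 'M[F]_(_, _)) i j *: f (vbasis {:U})`_i (vbasis {:V})`_j.

End Tensor.

Notation "u ⊗ v" := (tens u v) (at level 40, left associativity) : ring_scope.

Section TensorTheory.
Variables (F : fieldType) (U V : vectType F).

Fact tens_bilinear : bilinear_for *:%R *:%R (@tens F U V).
Proof.
split=> [v|u] a x y; apply/matrixP=> i j; rewrite !mxE linearP /=.
  by rewrite mulrDl mulrA.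
by rewrite mulrDr mulrCA.
Qed.

HB.instance Definition _ :=
  bilinear_isBilinear.Build F U V (tensor U V) *:%R *:%R (@tens F U V)
    tens_bilinear.

Lemma tlift_linear (W : lmodType F) (f : U -> V -> W) : linear (tlift f).
Proof.
move=> a s t; rewrite /tlift scaler_sumr -big_split; apply: eq_bigr => i _ /=.
rewrite scaler_sumr -big_split; apply: eq_bigr => j _ /=.
by rewrite !mxE scalerDl scalerA.
Qed.

Lemma tlift_tens (W : lmodType F) (f : U -> V -> W) :
  bilinear_for *:%R *:%R f -> forall u v, tlift f (u ⊗ v) = f u v.
Proof.
move=> [fl fr] u v.
have fl0 w : f 0 w = 0.
  by have /= := fl w (-1) 0 0; rewrite scaler0 addr0 scaleN1r addNr.
have fr0 w : f w 0 = 0.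
  by have /= := fr w (-1) 0 0; rewrite scaler0 addr0 scaleN1r addNr.
have fsl n (c : 'I_n -> F) (x : 'I_n -> U) w :
    f (\sum_i c i *: x i) w = \sum_i c i *: f (x i) w.
  elim/big_rec2: _ => [|i s t _ <-]; first exact: fl0.
  exact: fl.
have fsr n (c : 'I_n -> F) (x : 'I_n -> V) w :
    f w (\sum_i c i *: x i) = \sum_i c i *: f w (x i).
  elim/big_rec2: _ => [|i s t _ <-]; first exact: fr0.
  exact: fr.
rewrite [in RHS](coord_vbasis (memvf u)) [in RHS](coord_vbasis (memvf v)) fsl.
apply: eq_bigr => i _; rewrite fsr scaler_sumr; apply: eq_bigr => j _.
by rewrite mxE scalerA.
Qed.

Lemma tlift_sum (W : lmodType F) (f : U -> V -> W) :
  bilinear_for *:%R *:%R f -> forall n (u : 'I_n -> U) (v : 'I_n -> V),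
  tlift f (\sum_i u i ⊗ v i) = \sum_i f (u i) (v i).
Proof.
move=> bf n u v; elim/big_rec2: _ => [|i s t _ <-].
  by rewrite /tlift big1 // => i _; rewrite big1 // => j _; rewrite mxE scale0r.
by rewrite -[u i ⊗ v i]scale1r tlift_linear scale1r tlift_tens.
Qed.

Lemma tensor_span (t : tensor U V) :
  t = \sum_i \sum_j (t : 'M[F]_(_, _)) i j *:
        ((vbasis {:U})`_i ⊗ (vbasis {:V})`_j).
Proof.
apply/matrixP=> k l; rewrite summxE (bigD1 k) //= [X in _ + X]big1; last first.
  move=> i ik; rewrite summxE big1 // => j _; rewrite !mxE.
  by rewrite coord_free ?(basis_free (vbasisP _)) // (negPf ik) mul0r mulr0.
rewrite addr0 summxE (bigD1 l) //= big1; last first.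
  move=> j jl; rewrite !mxE [X in _ * (_ * X)]coord_free ?(basis_free (vbasisP _)) //.
  by rewrite (negPf jl) !mulr0.
by rewrite addr0 !mxE !coord_free ?(basis_free (vbasisP _)) // !eqxx !mulr1.
Qed.

Lemma tensor_ext (W : lmodType F) (g h : {linear tensor U V -> W}) :
  (forall u v, g (u ⊗ v) = h (u ⊗ v)) -> g =1 h.
Proof.
move=> gh t; rewrite (tensor_span t) !linear_sum; apply: eq_bigr => i _.
by rewrite !linear_sum; apply: eq_bigr => j _; rewrite !linearZ gh.
Qed.

Definition tswap : tensor U V -> tensor V U := tlift (fun u v => v ⊗ u).

End TensorTheory.

Section YangBaxter.
Variables (F : fieldType) (L : lieVectType F).

(* See cybe_lhs_sum for the value on r = \sum_i a i ⊗ b i. *)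
Definition cybe_lhs (r : tensor L L) : tensor (tensor L L) L :=
  tlift (fun a b => tlift (fun a' b' =>
    \[a, a'] ⊗ b ⊗ b' - a ⊗ \[a', b] ⊗ b' + a ⊗ a' ⊗ \[b, b']) r) r.

Definition CYBE (r : tensor L L) : Prop := cybe_lhs r = 0.

Definition tbracket (s : tensor L L) (y : L) : tensor L L :=
  tlift (fun c d => \[c, y] ⊗ d + c ⊗ \[d, y]) s.

Definition L_invariant (s : tensor L L) : Prop := forall y, tbracket s y = 0.

Lemma tswap_sum n (a b : 'I_n -> L) :
  tswap (\sum_i a i ⊗ b i) = \sum_i b i ⊗ a i.
Proof. by apply: tlift_sum; split=> w c x y; rewrite ?linearPl ?linearPr. Qed.

Lemma tbracket_sum n (c d : 'I_n -> L) y :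
  tbracket (\sum_i c i ⊗ d i) y =
  \sum_i (\[c i, y] ⊗ d i + c i ⊗ \[d i, y]).
Proof.
apply: tlift_sum; split=> w k u v /=; rewrite ?(linearPl, linearPr) scalerDr.
  by rewrite addrACA.
by rewrite addrACA.
Qed.

Lemma cybe_lhs_sum n (a b : 'I_n -> L) :
  cybe_lhs (\sum_i a i ⊗ b i) =
  \sum_i \sum_j (\[a i, a j] ⊗ b i ⊗ b j - a i ⊗ \[a j, b i] ⊗ b j
                 + a i ⊗ a j ⊗ \[b i, b j]).
Proof.
pose f (x y x' y' : L) : tensor (tensor L L) L :=
  \[x, x'] ⊗ y ⊗ y' - x ⊗ \[x', y] ⊗ y' + x ⊗ x' ⊗ \[y, y'].
have combine k (p q s p' q' s' : tensor (tensor L L) L) :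
    (k *: p + p') - (k *: q + q') + (k *: s + s') =
    k *: (p - q + s) + (p' - q' + s').
  by rewrite opprD (addrACA (k *: p)) (addrACA (k *: p - _)) scalerDr scalerBr.
have fin x y : bilinear_for *:%R *:%R (f x y).
  by split=> w k u v; rewrite /f ?(linearPl, linearPr) combine.
have fout : bilinear_for *:%R *:%R
    (fun x y => tlift (f x y) (\sum_i a i ⊗ b i)).
  split=> w k u v; rewrite /= !tlift_sum //= scaler_sumr -big_split;
    by apply: eq_bigr => i _; rewrite /f ?(linearPl, linearPr) combine.
rewrite /cybe_lhs (tlift_sum fout); apply: eq_bigr => i _.
exact: tlift_sum.
Qed.

End YangBaxter.

Section Quadratic.
Variables (F : fieldType) (L : lieVectType F).

Definition invariant_form (omega : L -> L -> F) : Prop :=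
  forall a b c, omega \[a, b] c = omega a \[b, c].

Definition quadratic_lie (omega : {symmetric L}) : Prop :=
  nondegenerate omega /\ invariant_form omega.

Definition adjoint_wrt (omega : L -> L -> F) (R Rs : L -> L) : Prop :=
  forall x y, omega (R x) y = omega x (Rs y).

Lemma adjoint_wrt_sum (omega : {symmetric L}) n (a b : 'I_n -> L) :
  adjoint_wrt omega (fun x => \sum_i omega (b i) x *: a i)
                    (fun y => \sum_i omega (a i) y *: b i).
Proof.
move=> x y; rewrite linear_sumr -[LHS]/(applyr omega y _) raddf_sum.
apply: eq_bigr => i _ /=; rewrite linearZl_LR linearZr_LR /= mulrC.
by rewrite (hermC omega x) expr0 mul1r.
Qed.

End Quadratic.

(* Main.v *)
Require Import Defs.
From HB Require Import structures.
From mathcomp Require Import all_boot all_order all_algebra.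

Set Implicit Arguments.
Unset Strict Implicit.
Unset Printing Implicit Defensive.

Import GRing.Theory.
Local Open Scope ring_scope.

(* Contracting the last tensor factors against the form turns both conditions
   on r into operator identities: r + tau r is L-invariant iff
   theta := R + R^* commutes with every ad y, and r solves the CYBE iff
   [R x, R y] = R [x, R y] - R [R^* x, y]. If R is Rota-Baxter of weight lam,
   the latter says R [theta x + lam x, y] = 0, so when theta commutes with the
   ad y it says that R kills (theta + lam) [L, L], which is then an ideal and
   serves as I_lam. *)

(** * Contraction against a nondegenerate form *)

Section Contraction.
Variables (F : fieldType) (L : vectType F) (omega : {symmetric L}).

Lemma symmetricC x y : omega x y = omega y x.
Proof. by rewrite hermC expr0 mul1r. Qed.

Hypothesis omega_nondeg : nondegenerate omega.

Lemma nondegenerate_eq0 x : (forall y, omega x y = 0) -> x = 0.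
Proof.
move=> x0; apply/eqP; rewrite -memv0 -(eqP omega_nondeg).
by apply/mem_orthovP=> y _.
Qed.

Lemma nondegenerate_inj x y : (forall z, omega z x = omega z y) -> x = y.
Proof.
move=> xy; apply/eqP; rewrite -subr_eq0; apply/eqP/nondegenerate_eq0 => z.
by rewrite linearBl /= symmetricC xy symmetricC subrr.
Qed.

(** Since tensors associate to the left, two contractions in a row take [L ⊗ L ⊗ L] down to [L]. *)
Definition contract (U : vectType F) (x : L) : tensor U L -> U :=
  tlift (fun u v => omega v x *: u).

HB.instance Definition _ U x :=
  GRing.isLinear.Build F (tensor U L) U *:%R (@contract U x)
    (tlift_linear _).

Lemma contract_tens (U : vectType F) x (u : U) v :
  contract x (u ⊗ v) = omega v x *: u.
Proof.
rewrite /contract tlift_tens //; split=> w k y z /=.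
  by rewrite scalerDr !scalerA mulrC.
by rewrite linearPl /= scalerDl scalerA.
Qed.

(** The coordinates of [contract x t] are the pairings of [x] with the rows of [t], read as vectors
    of [L]. They vanish because the basis of [U] is free; nondegeneracy then kills the rows, and
    freeness of the basis of [L] their entries. *)
Lemma contract_eq0 (U : vectType F) (t : tensor U L) :
  (forall x, contract x t = 0) -> t = 0.
Proof.
move=> t0; apply/matrixP=> i j; rewrite mxE.
have /freeP freeU := basis_free (vbasisP {:U}).
have /freeP freeL := basis_free (vbasisP {:L}).
apply: (freeL ((t : 'M[F]_(_, _)) i)); apply: nondegenerate_eq0 => x.
suff t0x : \sum_k (\sum_l (t : 'M[F]_(_, _)) k l * omega (vbasis {:L})`_l x) *:
    (vbasis {:U})`_k = 0.
  rewrite linear_sumlz -[RHS](freeU _ t0x i); apply: eq_bigr => l _.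
  by rewrite linearZl_LR.
rewrite -[RHS](t0 x) /contract /tlift; apply: eq_bigr => k _.
by rewrite scaler_suml; apply: eq_bigr => l _; rewrite scalerA.
Qed.

End Contraction.

(** * The derived algebra and its images under centroid maps *)

Section Derived.
Variables (F : fieldType) (L : lieVectType F).

(** A subspace counterpart of [in_derived], so that linear images can be taken; by bilinearity,
    basis vectors suffice as right arguments. *)
Definition derived : {vspace L} :=
  (\sum_(i < \dim {:L}) limg (linfun (applyr (@lie F L) (vbasis {:L})`_i)))%VS.

Lemma lie_derived x y : \[x, y] \in derived.
Proof.
rewrite (coord_vbasis (memvf y)) linear_sumr; apply: memv_suml => i _ /=.
rewrite linearZr_LR /= memvZ //; have -> : \[x, (vbasis {:L})`_i] =
    linfun (applyr (@lie F L) (vbasis {:L})`_i) x by rewrite lfunE.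
apply: (subvP (sumv_sup i isT (subvv _))).
exact: memv_img (memvf x).
Qed.

(** Each summand lies in the image of a single bracket map, so one bracket per basis vector is
    enough and no scalars are needed. *)
Lemma derivedP x :
  x \in derived <->
  exists n (u v : 'I_n -> L), x = \sum_i \[u i, v i].
Proof.
split=> [/memv_sumP[w wP ->]|[n [u [v ->]]]]; last first.
  by apply: memv_suml => i _; apply: lie_derived.
exists _, (fun i : 'I_(\dim {:L}) =>
  (linfun (applyr (@lie F L) (vbasis {:L})`_i))^-1%VF (w i)),
  (fun i => (vbasis {:L})`_i).
apply: eq_bigr => i _; rewrite -{1}(limg_lfunVK (wP i isT)).
by rewrite [LHS]lfunE.
Qed.

Lemma in_derivedP x : in_derived x <-> x \in derived.
Proof.
split=> [[n [c [u [v ->]]]]|/derivedP[n [u [v ->]]]].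
  by apply: memv_suml => i _; rewrite memvZ ?lie_derived.
by exists n, (fun=> 1), u, v; apply: eq_bigr => i _; rewrite scale1r.
Qed.

Lemma quot_op_rota_baxter (I : ideal L) lam (R : L -> L) :
  (forall x, x \in ideal_space I -> R x \in ideal_space I) ->
  rota_baxter lam R -> rota_baxter lam (quot_op I R).
Proof.
move=> RI [linR RB]; have qE := quot_opE linR RI.
split=> [c x y|x y].
  rewrite -[x]quot_reprK -[y]quot_reprK -linearP !qE linR.
  exact: linearP.
rewrite -[x]quot_reprK -[y]quot_reprK !qE.
rewrite -[lie _ _]quot_pi_lie RB -qE; congr (quot_op I R _).
by rewrite !linearD linearZ /= !quot_pi_lie.
Qed.

Section CentroidIdeal.
Variable theta : {linear L -> L}.
Hypothesis theta_lie : forall x y, theta \[x, y] = \[theta x, y].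

(** [theta] is in the centroid, so [[theta u, y] = theta [u, y]] is again the image of a bracket. *)
Lemma centroid_idealP x y :
  x \in (linfun theta @: derived)%VS -> \[x, y] \in (linfun theta @: derived)%VS.
Proof.
move=> /memv_imgP[u uD ->]; rewrite lfunE /= -theta_lie.
by rewrite -[theta _]lfunE memv_img ?lie_derived.
Qed.

Definition centroid_ideal : ideal L := Ideal centroid_idealP.

Lemma mem_centroid_ideal x :
  x \in ideal_space centroid_ideal <-> exists2 u, u \in derived & x = theta u.
Proof.
split=> [/memv_imgP[u uD ->]|[u uD ->]]; first by exists u; rewrite ?lfunE.
by rewrite -[theta u]lfunE memv_img.
Qed.

Lemma centroid_ideal_derived x :
  x \in ideal_space centroid_ideal -> x \in derived.
Proof.
case/mem_centroid_ideal=> _ /derivedP[n [u [v ->]]] ->.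
rewrite linear_sum; apply: memv_suml => i _.
by rewrite theta_lie lie_derived.
Qed.

End CentroidIdeal.
End Derived.

(** * Invariance and the CYBE as operator identities *)

Section TensorOperator.
Variables (F : fieldType) (L : lieVectType F) (omega : {symmetric L}).
Hypothesis homega : quadratic_lie omega.
Variables (n : nat) (a b : 'I_n -> L) (R Rs : L -> L).
Hypothesis R_E : forall x, R x = \sum_i omega (b i) x *: a i.
Hypothesis RsP : adjoint_wrt omega R Rs.

Let nondeg : nondegenerate omega. Proof. by case: homega. Qed.
Let inv : invariant_form omega. Proof. by case: homega. Qed.

(** Nondegeneracy makes the adjoint unique, and [adjoint_wrt_sum] provides one. *)
Lemma adjointE x : Rs x = \sum_i omega (a i) x *: b i.
Proof.
apply: (nondegenerate_inj nondeg) => z.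
by rewrite -RsP -adjoint_wrt_sum R_E.
Qed.

Lemma tensor_operator_linear : linear R.
Proof.
move=> k x y; rewrite !R_E scaler_sumr -big_split; apply: eq_bigr => i _ /=.
by rewrite linearPr scalerDl scalerA.
Qed.

Lemma adjoint_linear : linear Rs.
Proof.
move=> k x y; rewrite !adjointE scaler_sumr -big_split; apply: eq_bigr => i _ /=.
by rewrite linearPr scalerDl scalerA.
Qed.

(** Contracting [c ⊗ [d, y]] produces [omega [d, y] x = - omega d [x, y]] by invariance. So r yields
    the terms in [R], and tau r, with [a] and [b] exchanged, those in [Rs]. *)
Lemma contract_tbracket x y :
  contract omega x
    (tbracket (\sum_i a i ⊗ b i + tswap (\sum_i a i ⊗ b i)) y) =
  \[R x + Rs x, y] - (R \[x, y] + Rs \[x, y]).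
Proof.
have tbD s t : tbracket (s + t) y = tbracket s y + tbracket t y.
  by rewrite -[s]scale1r /tbracket tlift_linear !scale1r.
have half (c d : 'I_n -> L) :
    contract omega x (tbracket (\sum_i c i ⊗ d i) y) =
    \[\sum_i omega (d i) x *: c i, y] - \sum_i omega (d i) \[x, y] *: c i.
  rewrite tbracket_sum raddf_sum linear_sumlz -sumrB; apply: eq_bigr => i _.
  rewrite raddfD /= !contract_tens linearZl_LR inv [\[y, x]]lieC linearNr /=.
  by rewrite scaleNr.
rewrite tswap_sum tbD raddfD /= !half !(R_E, adjointE) linearDl.
by rewrite opprD addrACA.
Qed.

Lemma L_invariantE :
  L_invariant (\sum_i a i ⊗ b i + tswap (\sum_i a i ⊗ b i)) <->
  forall x y, R \[x, y] + Rs \[x, y] = \[R x + Rs x, y].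
Proof.
split=> [h x y|h y].
  by apply/esym/eqP; rewrite -subr_eq0 -contract_tbracket h raddf0.
by apply: (contract_eq0 nondeg) => x; rewrite contract_tbracket h subrr.
Qed.

(** The second factor is paired with [x] and the third with [y]; the three sums of the CYBE become
    the three terms on the right, in the same order. *)
Lemma contract_cybe x y :
  contract omega x (contract omega y (cybe_lhs (\sum_i a i ⊗ b i))) =
  \[R x, R y] - R \[x, R y] + R \[Rs x, y].
Proof.
have contract2_tens u v w : contract omega x (contract omega y (u ⊗ v ⊗ w)) =
    omega w y *: (omega v x *: u) by rewrite contract_tens linearZ /= contract_tens.
rewrite cybe_lhs_sum [contract omega y _]raddf_sum [LHS]raddf_sum.
have -> : \[R x, R y] =
    \sum_i \sum_j omega (b j) y *: (omega (b i) x *: \[a i, a j]).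
  rewrite !R_E linear_sumlz; apply: eq_bigr => i _.
  rewrite linear_sumr; apply: eq_bigr => j _ /=.
  by rewrite linearZl_LR linearZr_LR /= !scalerA mulrC.
have -> : R \[x, R y] =
    \sum_i \sum_j omega (b j) y *: (omega \[a j, b i] x *: a i).
  rewrite (R_E \[_, _]); apply: eq_bigr => i _.
  rewrite R_E !linear_sumr scaler_suml; apply: eq_bigr => j _ /=.
  (* Invariance, used twice around symmetry, gives [omega [a_j, b_i] x = omega b_i [x, a_j]]. *)
  by rewrite !linearZr_LR /= -scalerA inv [omega (a j) _]symmetricC inv.
have -> : R \[Rs x, y] =
    \sum_i \sum_j omega \[b i, b j] y *: (omega (a j) x *: a i).
  rewrite R_E; apply: eq_bigr => i _.
  rewrite adjointE linear_sumlz linear_sumr scaler_suml.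
  apply: eq_bigr => j _ /=.
  by rewrite linearZl_LR linearZr_LR /= inv scalerA mulrC.
rewrite -sumrB -big_split; apply: eq_bigr => i _ /=.
rewrite [contract omega y _]raddf_sum [LHS]raddf_sum -sumrB -big_split.
apply: eq_bigr => j _ /=.
by rewrite 2!raddfD 2!raddfD !raddfN /= !contract2_tens.
Qed.

Lemma CYBE_E :
  CYBE (\sum_i a i ⊗ b i) <->
  forall x y, \[R x, R y] = R \[x, R y] - R \[Rs x, y].
Proof.
split=> [h x y|h].
  apply/eqP; rewrite -subr_eq0 opprB addrCA addrC -contract_cybe h.
  by rewrite !raddf0.
apply: (contract_eq0 nondeg) => y; apply: (contract_eq0 nondeg) => x.
by rewrite contract_cybe h addrAC subrK subrr.
Qed.

(** The term [R [x, R y]] occurs in both the Rota-Baxter and the CYBE identity and cancels; the rest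
    collects under one [R]. *)
Lemma rota_baxter_CYBE_E lam : rota_baxter lam R ->
  CYBE (\sum_i a i ⊗ b i) <->
  forall x y, R \[R x + Rs x + lam *: x, y] = 0.
Proof.
case=> linR RB.
pose HRm := GRing.isLinear.Build F L L *:%R R linR.
pose Rl : {linear L -> L} := HB.pack R HRm.
have RD u v : R (u + v) = R u + R v := raddfD Rl u v.
suff E x y : R \[R x + Rs x + lam *: x, y] =
    \[R x, R y] - (R \[x, R y] - R \[Rs x, y]).
  split=> [/CYBE_E h x y|h]; first by rewrite E h subrr.
  by apply/CYBE_E => x y; apply/eqP; rewrite -subr_eq0 -E h.
rewrite RB !linearDl linearZl_LR !RD opprB /=.
move: (R \[R x, y]) (R \[x, R y]) (R \[Rs x, y]) (R (_ *: _)) => p q r t.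
by rewrite [in RHS](addrAC p) -[RHS]addrA [q + _]addrC subrK addrAC.
Qed.

End TensorOperator.

(** * The two implications *)

Theorem corollary2 (F : fieldType) (hF : [pchar F] =i pred0)
    (L : lieVectType F) (omega : {symmetric L}) (homega : quadratic_lie omega)
    (n : nat) (a b : 'I_n -> L)
    (r : tensor L L) (hr : r = \sum_(i < n) a i ⊗ b i)
    (R : L -> L) (hR : forall x, R x = \sum_(i < n) omega (b i) x *: a i)
    (Rs : L -> L) (hRs : adjoint_wrt omega R Rs)
    (lam : F) :
  (CYBE r -> L_invariant (r + tswap r) -> rota_baxter lam R ->
   exists I : ideal L,
     [/\ forall x, x \in ideal_space I -> in_derived x,
         forall x, x \in ideal_space I -> R x = 0,
         rota_baxter lam (quot_op I R)
       & forall x, in_derived x -> R x + Rs x + lam *: x \in ideal_space I])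
  /\
  (r + tswap r != 0 -> rota_baxter lam R ->
   (forall x y, R \[x, y] + Rs \[x, y] = \[R x, y] + \[Rs x, y]) ->
   (exists I : ideal L,
     [/\ forall x, x \in ideal_space I -> in_derived x,
         forall x, x \in ideal_space I -> R x = 0,
         rota_baxter lam (quot_op I R)
       & forall x, in_derived x -> R x + Rs x + lam *: x \in ideal_space I]) ->
   [/\ CYBE r, r + tswap r != 0 & L_invariant (r + tswap r)]).
Proof.
subst r.
pose Rl : {linear L -> L} :=
  HB.pack R (GRing.isLinear.Build F L L *:%R R (tensor_operator_linear hR)).
pose Rsl : {linear L -> L} :=
  HB.pack Rs (GRing.isLinear.Build F L L *:%R Rs
    (adjoint_linear homega hR hRs)).
split=> [cybe inv RB|rN0 RB comm [I [_ RI0 _ thetaI]]]; last first.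
  have comm' x y : R \[x, y] + Rs \[x, y] = \[R x + Rs x, y].
    by rewrite comm linearDl.
  split=> //; last exact/(L_invariantE homega hR hRs).
  apply/(rota_baxter_CYBE_E homega hR hRs RB) => x y.
  (* [comm'] turns the argument of [R] into [(R + Rs + lam) [x, y]], which lies in [I] since
     [[x, y]] is in the derived algebra. *)
  rewrite linearDl linearZl_LR /= -comm' RI0 // thetaI //.
  exact/in_derivedP/lie_derived.
have {inv}comm := (L_invariantE homega hR hRs).1 inv.
have {cybe}R0 := (rota_baxter_CYBE_E homega hR hRs RB).1 cybe.
(* This [theta] includes the summand [lam]; it stays in the centroid because scalars are there. *)
pose theta : {linear L -> L} := (Rl \+ Rsl) \+ ( *:%R lam).
have theta_lie x y : theta \[x, y] = \[theta x, y].
  by rewrite /= comm -linearZl_LR -linearDl.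
have RI0 x : x \in ideal_space (centroid_ideal theta_lie) -> R x = 0.
  case/mem_centroid_ideal=> _ /derivedP[m [u [v ->]]] ->.
  (* On brackets, [R (theta [u, v]) = R [theta u, v]], which vanishes by [R0]. *)
  rewrite linear_sum -[R]/(Rl : L -> L) linear_sum big1 // => i _.
  by rewrite theta_lie; apply: R0.
exists (centroid_ideal theta_lie); split=> // [x /centroid_ideal_derived||].
- by move/in_derivedP.
(* [R] maps the ideal to 0, hence into itself, so it descends to the quotient. *)
- by apply: quot_op_rota_baxter RB => x /RI0 ->; rewrite mem0v.
by move=> x /in_derivedP xD; apply/mem_centroid_ideal; exists x.
Qed.
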